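(* Let $q\ge 2$ and $n\ge 1$ be integers, and let $S=(s_i)$ be a special orientable sequence of order $n$ over $\mathbb{Z}_q$ with period $m$. Let $h$ be the additive order of $w_q(S)$ in $\mathbb{Z}_q$. Then there are $q/h$ sequences $T_1,\dots,T_{q/h}$, each a special orientable sequence of order $n+1$ with period $hm$, which are translates of one another and pairwise special-o-disjoint, such that $D^{-1}(S)$ consists exactly of the $h$ shifts $(t_{i+km})_i$, $0\le k\le h-1$, of each $T_\ell=(t_i)$.
   Context: Sequences are periodic with entries in $\mathbb{Z}_q$; the period means the least period. For $S=(s_i)$ of period $m$, $\mathbf{s}_n(i)=(s_i,\dots,s_{i+n-1})$ and $w_q(S)=\sum_{i=0}^{m-1}s_i \bmod q$. For $\mathbf{u}=(u_0,\dots,u_{n-1})$, $\mathbf{u}^R=(u_{n-1},\dots,u_0)$ and $-\mathbf{u}=(-u_0,\dots,-u_{n-1})$. $S$ is an $n$-window sequence if $\mathbf{s}_n(i)=\mathbf{s}_n(j)$ implies $i\equiv j\pmod m$. $S$ is a special orientable sequence of order $n$ if it is an $n$-window sequence with $\mathbf{s}_n(i)\neq\mathbf{s}_n(j)^R$ and $\mathbf{s}_n(i)\neq-\mathbf{s}_n(j)^R$ for all $i,j$. Two $n$-window sequences $S,S'$ are special-o-disjoint if for all $i,j$: $\mathbf{s}_n(i)\neq\mathbf{s}'_n(j)$, $\mathbf{s}_n(i)\neq\mathbf{s}'_n(j)^R$ and $\mathbf{s}_n(i)\neq-\mathbf{s}'_n(j)^R$. A translate of $(t_i)$ is $(t_i+\lambda)$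 for nonzero $\lambda\in\mathbb{Z}_q$; a shift is $(t_{i+k})$. $D$ maps $(t_i)$ to $(t_{i+1}-t_i)$, and $D^{-1}(S)$ is the set of all periodic sequences $T$ with $D(T)=S$. *)

(* Defs.v *)
From HB Require Import structures.
From mathcomp Require Import all_boot all_order all_algebra all_fingroup.
Set Implicit Arguments.
Unset Strict Implicit.
Unset Printing Implicit Defensive.
Import GRing.Theory.
Local Open Scope ring_scope.

(* Sequences are indexed by nat and periodic from index 0 on, which is the
   same data as a periodic two-sided sequence. 'Z_q is Z/qZ only for q > 1. *)
Definition zseq (q : nat) := nat -> 'Z_q.

Section Sequences.
Variable q : nat.
Implicit Types (S T : zseq q) (u : seq 'Z_q) (m n p : nat).

Definition has_period p S : Prop := forall i, S (i + p)%N = S i.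

Definition periodic S : Prop := exists2 p, (0 < p)%N & has_period p S.

Definition least_period m S : Prop :=
  [/\ (0 < m)%N, has_period m S
    & forall p, (0 < p)%N -> has_period p S -> (m <= p)%N].

Definition window n S (i : nat) : seq 'Z_q := mkseq (fun j => S (i + j)%N) n.

Definition negw u : seq 'Z_q := map -%R u.

Definition weight m S : 'Z_q := \sum_(i < m) S i.

Definition window_sequence n m S : Prop :=
  least_period m S /\
  forall i j, window n S i = window n S j -> i = j %[mod m].

Definition special_orientable n m S : Prop :=
  [/\ window_sequence n m S,
      forall i j, window n S i <> rev (window n S j)
    & forall i j, window n S i <> negw (rev (window n S j))].

Definition special_o_disjoint n S S' : Prop :=
  forall i j,
    [/\ window n S i <> window n S' j,
        window n S i <> rev (window n S' j)
      & window n S i <> negw (rev (window n S' j))].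

Definition is_translate S T : Prop :=
  exists2 c : 'Z_q, c != 0 & T =1 (fun i => S i + c).

Definition shift k S : zseq q := fun i => S (i + k)%N.

Definition D S : zseq q := fun i => S i.+1 - S i.

Definition in_Dinv S T : Prop := periodic T /\ D T =1 S.

End Sequences.

(* The finite group structure of 'Z_q is the additive one, so that #[x]%g is
   the least k > 0 with x *+ k = 0. *)
Definition add_order (q : nat) (x : 'Z_q) : nat := #[x]%g.

(* Main.v *)
Require Import Defs.
From HB Require Import structures.
From mathcomp Require Import all_boot all_order all_algebra all_fingroup.
From mathcomp Require Import cyclic.
Set Implicit Arguments.
Unset Strict Implicit.
Unset Printing Implicit Defensive.

(* The preimages of S under D are the sequences c + P, with P the sequence of
   partial sums of S. They satisfy T (i + k m) = T i + k w with w the weight of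
   S, so shifting by multiples of m moves c inside its coset of <w>. As <w> is
   the subgroup generated by q / h, the constants 0, ..., q / h - 1 represent
   the cosets. Finally D maps reversed windows to negated reversed windows and
   vice versa, so reversal coincidences between preimages descend to S. *)

Import GRing.Theory.

Section Windows.
Local Open Scope ring_scope.
Variable q : nat.
Implicit Types S T U : zseq q.

Lemma eq_windowP n S T i j :
  window n S i = window n T j <->
  forall a, (a < n)%N -> S (i + a)%N = T (j + a)%N.
Proof.
split=> [eqST a ltan | eqST].
  by have := congr1 (nth 0 ^~ a) eqST; rewrite !nth_mkseq.
apply: (@eq_from_nth _ 0) => [|a]; rewrite !size_mkseq // => ltan.
by rewrite !nth_mkseq // eqST.
Qed.

Lemma eq_window_revP n S T i j :
  window n S i = rev (window n T j) <->
  forall a, (a < n)%N -> S (i + a)%N = T (j + (n - a.+1))%N.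
Proof.
split=> [eqST a ltan | eqST].
  have := congr1 (nth 0 ^~ a) eqST.
  rewrite nth_mkseq // nth_rev size_mkseq // nth_mkseq //.
  by rewrite ltn_subrL; case: n ltan {eqST}.
apply: (@eq_from_nth _ 0) => [|a]; rewrite ?size_rev !size_mkseq // => ltan.
rewrite nth_mkseq // nth_rev size_mkseq // nth_mkseq ?eqST //.
by rewrite ltn_subrL; case: n ltan {eqST}.
Qed.

Lemma eq_window_neg_revP n S T i j :
  window n S i = negw (rev (window n T j)) <->
  forall a, (a < n)%N -> S (i + a)%N = - T (j + (n - a.+1))%N.
Proof.
have -> : negw (rev (window n T j)) = rev (window n (fun i => - T i) j).
  by rewrite /negw map_rev -map_comp.
exact: eq_window_revP.
Qed.

Lemma window_D n S T U i j : D T =1 S -> D U =1 S ->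
  window n.+1 T i = window n.+1 U j -> window n S i = window n S j.
Proof.
move=> DT DU /eq_windowP eqTU; apply/eq_windowP => a ltan.
by rewrite -DT -DU /D -!addnS !eqTU // ltnS ltnW.
Qed.

(** Reading a window backwards swaps the two terms of every difference, which reverses the
    differences and changes their signs. *)
Lemma window_rev_D n S T U i j : D T =1 S -> D U =1 S ->
  window n.+1 T i = rev (window n.+1 U j) ->
  window n S i = negw (rev (window n S j)).
Proof.
move=> DT DU /eq_window_revP eqTU; apply/eq_window_neg_revP => a ltan.
rewrite -DT -DU /D -!addnS !eqTU ?ltnS ?(ltnW ltan) //.
by rewrite !subSS opprB -subSn ?subSS.
Qed.

(** Here the sign change due to reversal cancels against the given negation. *)
Lemma window_neg_rev_D n S T U i j : D T =1 S -> D U =1 S ->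
  window n.+1 T i = negw (rev (window n.+1 U j)) ->
  window n S i = rev (window n S j).
Proof.
move=> DT DU /eq_window_neg_revP eqTU; apply/eq_window_revP => a ltan.
rewrite -DT -DU /D -!addnS !eqTU ?ltnS ?(ltnW ltan) //.
by rewrite !subSS opprK addrC -subSn ?subSS.
Qed.

End Windows.

Section Preimages.
Local Open Scope ring_scope.
Variable q : nat.
Implicit Types S T U : zseq q.

Definition psum S (c : 'Z_q) : zseq q := fun i => c + \sum_(j < i) S j.

Lemma D_psum S c : D (psum S c) =1 S.
Proof.
by move=> i; rewrite /D /psum big_ord_recr /= addrA [_ + S i]addrC addrK.
Qed.

Lemma psum_D S T : D T =1 S -> T =1 psum S (T 0).
Proof.
move=> DT; elim=> [|i IHi]; first by rewrite /psum big_ord0 addr0.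
by rewrite /psum big_ord_recr addrA -/(psum S (T 0) i) -IHi /= -DT /D addrC subrK.
Qed.

Lemma psum_shift S m c k i : has_period m S ->
  psum S c (i + k * m)%N = psum S (c + weight m S *+ k) i.
Proof.
move=> perS; elim: k c i => [|k IHk] c i; first by rewrite mulr0n addr0 addn0.
(* One full period adds the weight: at [i = 0] this is the definition of [weight], and afterwards
   both sides gain equal terms because [m] is a period. *)
have shift1 c' : psum S c' (i + m)%N = psum S (c' + weight m S) i.
  elim: i {IHk} => [|i IHi]; first by rewrite /psum big_ord0 addr0.
  by rewrite addSn /psum !big_ord_recr !addrA -!/(psum _ _ _) IHi /= perS.
have := IHk c (i + m)%N.
by rewrite mulSn addnA shift1 => ->; rewrite mulrSr addrA.
Qed.

Lemma mulrn_eq0_order (w : 'Z_q) k : (w *+ k == 0) = (add_order w %| k)%N.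
Proof. by rewrite order_dvdn FinRing.zmodXgE. Qed.

Lemma add_order_gt0 (w : 'Z_q) : (0 < add_order w)%N.
Proof. exact: order_gt0. Qed.

(** The [n] differences inside a window of length [n.+1] fix the position mod [m]; its first entry
    then compares the constants. Allowing [c] and [c'] to differ serves both the window property and
    disjointness. *)
Lemma psum_window n m S c c' i j : window_sequence n m S ->
  window n.+1 (psum S c) i = window n.+1 (psum S c') j ->
  i = j %[mod m] /\
  c + weight m S *+ (i %/ m) = c' + weight m S *+ (j %/ m).
Proof.
move=> [[_ perS _] winS] eqcc.
have eqij := winS _ _ (window_D (D_psum S c) (D_psum S c') eqcc).
split=> //.
have /eq_windowP/(_ 0 isT) := eqcc; rewrite !addn0.
(* Full periods move into the constants, and the partial sum up to the common residue cancels. *)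
rewrite {1}(divn_eq i m) {1}(divn_eq j m) -eqij ![(_ + i %% m)%N]addnC.
rewrite !psum_shift //; exact: addIr.
Qed.

Lemma psum_least_period n m S c : window_sequence n m S ->
  least_period (add_order (weight m S) * m) (psum S c).
Proof.
move=> winS; have [[m_gt0 perS _] _] := winS; split.
- by rewrite muln_gt0 add_order_gt0.
- move=> i; rewrite psum_shift //.
  by have /eqP -> : weight m S *+ add_order (weight m S) == 0;
    rewrite ?addr0 ?mulrn_eq0_order.
move=> p p_gt0 perp.
(* A period [p] makes the windows at [p] and [0] equal, so [m] divides [p] and the order of the
   weight divides [p %/ m]. *)
have /(psum_window winS)[eqp +] :
    window n.+1 (psum S c) p = window n.+1 (psum S c) 0.
  by apply/eq_windowP => a _; rewrite addnC perp.
rewrite div0n => /addrI/eqP; rewrite mulrn_eq0_order => dvdhp.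
have /divnK <- : (m %| p)%N by rewrite /dvdn eqp mod0n.
rewrite leq_mul2r dvdn_leq ?orbT // divn_gt0 // dvdn_leq //.
by rewrite /dvdn eqp mod0n.
Qed.

Lemma psum_special_orientable n m S c : special_orientable n m S ->
  special_orientable n.+1 (add_order (weight m S) * m) (psum S c).
Proof.
move=> [winS revS nrevS]; split.
- split=> [|i j]; first exact: psum_least_period winS.
  (* The order lets [j %/ m - i %/ m] be a true difference in [nat]. *)
  wlog leij: i j / (i <= j)%N => [Hw eqw|].
    by case: (leqP i j) => [/Hw-> // | /ltnW/Hw->].
  move=> /(psum_window winS)[eqij] => /addrI/eqP.
  have lek : (i %/ m <= j %/ m)%N by apply: leq_div2r.
  rewrite eq_sym -subr_eq0 -mulrnBr // mulrn_eq0_order => dvdh.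
  apply/esym/eqP; rewrite eqn_mod_dvd // {1}(divn_eq j m) {1}(divn_eq i m) eqij.
  by rewrite subnDr -mulnBl dvdn_mul.
(* The two reversal conditions on [S] exchange roles. *)
- by move=> i j /(window_rev_D (D_psum S c) (D_psum S c))/nrevS.
- by move=> i j /(window_neg_rev_D (D_psum S c) (D_psum S c))/revS.
Qed.

End Preimages.

Section Cosets.
Local Open Scope ring_scope.
Variables (q : nat) (w : 'Z_q).
Hypothesis hq : (1 < q)%N.
Let h := add_order w.
Let d := (q %/ h)%N.

Lemma order_Zq1 : #[1%R : 'Z_q]%g = q.
Proof. exact: etrans (order_Zp1 _) (Zp_cast hq). Qed.

Lemma add_order_dvd : (h %| q)%N.
Proof. by rewrite -mulrn_eq0_order -mulr_natr pchar_Zp // mulr0. Qed.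

(** A cyclic group has at most one subgroup of each order, and both generators have order [h], since
    [d] divides [q] with quotient [h]. *)
Lemma cycle_add_order : <[w]>%g = <[d%:R : 'Z_q]>%g.
Proof.
have sub1 (x : 'Z_q) : <[x]>%g \subset <[1%R : 'Z_q]>%g.
  by rewrite cycle_subG -[x]natr_Zp -FinRing.zmodXgE mem_cycle.
have dvdq : (d %| q)%N by rewrite -(divnK add_order_dvd) dvdn_mulr.
apply/eqP; rewrite (eq_subG_cyclic (cycle_cyclic (1%R : 'Z_q))) ?sub1 //.
rewrite -FinRing.zmodXgE -!orderE orderXdiv ?order_Zq1 //.
by rewrite divnA ?add_order_dvd // mulKn // ltnW.
Qed.

Lemma coset_decomp (x : 'Z_q) :
  exists l : 'I_d, exists2 k, (k < h)%N & x = (l : nat)%:R + w *+ k.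
Proof.
have d_gt0 : (0 < d)%N.
  by rewrite divn_gt0 ?add_order_gt0 // dvdn_leq ?add_order_dvd // ltnW.
(* In the division of [x] by [d], the remainder serves as [l], and the multiple of [d] lies in the
   subgroup of [w], which yields [k < h]. *)
have : ((x %/ d)%N%:R * d%:R : 'Z_q) \in <[w]>%g.
  by rewrite cycle_add_order mulrC mulr_natr -FinRing.zmodXgE mem_cycle.
case/cyclePmin => k ltkh eqk; exists (Ordinal (ltn_pmod x d_gt0)), k => //=.
by rewrite -[w *+ k]FinRing.zmodXgE -eqk -natrM -natrD addnC -divn_eq natr_Zp.
Qed.

(** Reduction mod [d] is well defined because [d] divides [q]; it kills the multiples of [w] and
    fixes [l] and [l'], which are below [d]. *)
Lemma coset_inj (l l' : 'I_d) k k' :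
  (l : nat)%:R + w *+ k = (l' : nat)%:R + w *+ k' -> l = l'.
Proof.
have /cycleP[e ->] : w \in <[d%:R : 'Z_q]>%g by rewrite -cycle_add_order cycle_id.
rewrite !FinRing.zmodXgE -!mulrnA -!natrD => /(congr1 val).
rewrite /= !val_Zp_nat // => /(congr1 (modn^~ d)).
have dvdq : (d %| q)%N by rewrite -(divnK add_order_dvd) dvdn_mulr.
rewrite !modn_dvdm //.
by rewrite ![(_ + d * _)%N]addnC ![(d * _)%N]mulnC !modnMDl !modn_small // => /val_inj.
Qed.

End Cosets.

Theorem theorem7 (q n m : nat) (S : zseq q) (hq : 1 < q) (hn : 0 < n)
    (hS : special_orientable n m S) :
  let h := add_order (weight m S) in
  exists T : 'I_(q %/ h) -> zseq q,
    [/\ forall l, special_orientable n.+1 (h * m) (T l),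
        forall l l', l != l' -> is_translate (T l) (T l'),
        forall l l', l != l' -> special_o_disjoint n.+1 (T l) (T l')
      & forall U : zseq q,
          in_Dinv S U <->
          exists l, exists2 k, k < h & U =1 shift (k * m) (T l)].
Proof.
move=> h; have [winS revS nrevS] := hS; have [[m_gt0 perS _] _] := winS.
exists (fun l => psum S (l : nat)%:R%R); split.
- by move=> l; apply: psum_special_orientable.
- move=> l l' neq; exists ((l' : nat)%:R - (l : nat)%:R)%R.
    apply: contra neq; rewrite subr_eq0 => /eqP eql.
    by apply/eqP/(@coset_inj _ _ hq l l' 0 0); rewrite eql.
  by move=> i; rewrite /psum addrAC addrCA subrr addr0.
- move=> l l' /eqP neq i j; split=> eqw.
  + by have [_ /(coset_inj hq) /neq] := psum_window winS eqw.
  + exact: nrevS (window_rev_D (D_psum _ _) (D_psum _ _) eqw).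
  + exact: revS (window_neg_rev_D (D_psum _ _) (D_psum _ _) eqw).
move=> U; split=> [[_ DU] | [l [k _ eqU]]].
  (* The initial value determines [U]: its coset selects [l], its place in the coset the shift
     [k]. *)
  have [l [k ltkh eqU0]] := coset_decomp (weight m S) hq (U 0%N).
  by exists l, k => // i; rewrite (psum_D DU) eqU0 /shift psum_shift.
have {}eqU i : U i = psum S ((l : nat)%:R + weight m S *+ k)%R i.
  by rewrite eqU /shift psum_shift.
split; last by move=> i; rewrite /D !eqU; apply: D_psum.
have [hm_gt0 perU _] := psum_least_period ((l : nat)%:R + weight m S *+ k)%R winS.
by exists (h * m)%N => // i; rewrite !eqU perU.
Qed.
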